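(* Let $d$ be a positive integer. (i) For any finite family $\mathcal{F}$ of bounded convex sets in $\mathbb{R}^d$, \[\lim_{\|x\|\to\infty}\operatorname{dep}_\mathcal{F}(x)=0.\] (ii) For any finite family $\mathcal{F}$ of convex sets in $\mathbb{R}^d$ that is symmetric about the origin and any $x\in\mathbb{R}^d$, the function $D:\mathbb{R}_{\ge 0}\to\mathbb{Z}$ given by $D(a)=\operatorname{dep}_\mathcal{F}(ax)$ is decreasing (i.e. $D(a)\ge D(b)$ whenever $0\le a\le b$).
   Context: For a finite family $\mathcal{F}$ of convex sets in $\mathbb{R}^d$ and a point $p\in\mathbb{R}^d$, the depth $\operatorname{dep}_\mathcal{F}(p)$ is the smallest number of sets of $\mathcal{F}$ intersected by a closed halfspace that contains $p$. A family $\mathcal{F}$ is symmetric about the origin if for every $F\in\mathcal{F}$ the set $-F$ is also in $\mathcal{F}$. *)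

(* Defs.v *)
From HB Require Import structures.
From mathcomp Require Import all_boot all_order all_algebra finmap.
From mathcomp Require Import all_classical all_reals all_analysis.

Set Implicit Arguments.
Unset Strict Implicit.
Unset Printing Implicit Defensive.

Import Order.TTheory GRing.Theory Num.Theory.
Import numFieldNormedType.Exports.

Local Open Scope classical_set_scope.
Local Open Scope ring_scope.

Section Depth.
Variables (R : realType) (d : nat).
Implicit Types (p u x y : 'rV[R]_d) (A H : set 'rV[R]_d).
Implicit Types F : set (set 'rV[R]_d).

Definition dot u y : R := \sum_(i < d) u ord0 i * y ord0 i.

(* The norm `|x| that the library puts on 'rV[R]_d is the sup norm. *)
Definition enorm x : R := Num.sqrt (dot x x).

(* The filter "||x|| -> oo" on R^d. *)
Definition enorm_infty : set_system 'rV[R]_d :=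
  filter_from [set: R] (fun M => [set x | M <= enorm x]).

Global Instance enorm_infty_filter : Filter enorm_infty.
Proof.
apply: filter_from_filter; first by exists 0.
move=> M N _ _; exists (Num.max M N) => // x /=.
by rewrite ge_max => /andP[].
Qed.

Definition closed_halfspace H : Prop :=
  exists u (c : R), u != 0 /\ H = [set y | c <= dot u y].

(* Meaningful when F is finite: fset_set maps an infinite set to fset0. *)
Definition hits F H : nat :=
  #|` fset_set [set A | F A /\ A `&` H !=set0] |.

(* A family is a set of sets, without multiplicities. The default 0 of xget
   is used only when d = 0, where R^d has no closed halfspace (see depthP). *)
Definition depth F p : nat :=
  xget 0%N [set n : nat |
    (exists H, [/\ closed_halfspace H, H p & hits F H = n]) /\
    forall H, closed_halfspace H -> H p -> (n <= hits F H)%N].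

Lemma depthP F p : (0 < d)%N ->
  (exists H, [/\ closed_halfspace H, H p & hits F H = depth F p]) /\
  forall H, closed_halfspace H -> H p -> (depth F p <= hits F H)%N.
Proof.
move=> d0; rewrite /depth; case: xgetP => // nomin; exfalso.
pose P (n : nat) := `[< exists H, [/\ closed_halfspace H, H p & hits F H = n] >].
have u0 : (const_mx 1 : 'rV[R]_d) != 0.
  apply/eqP => /rowP /(_ (Ordinal d0)) /eqP.
  by rewrite !mxE oner_eq0.
have exP : exists n, P n.
  pose H := [set y | dot (const_mx 1) p <= dot (const_mx 1) y].
  exists (hits F H); apply/asboolP; exists H; split => //; last exact: lexx.
  by exists (const_mx 1), (dot (const_mx 1) p).
have [n /asboolP Pn nmin] := find_ex_minn exP.
apply: (nomin n); split=> // H hH Hp; apply: nmin.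
by apply/asboolP; exists H.
Qed.

Definition symmetric_family F : Prop :=
  forall A, F A -> F [set - x | x in A].

End Depth.

(* Main.v *)
(* For (i), take M bounding the coordinates of all points of all members of the
   family. If ||x|| > d M, the halfspace {y | <x, x> <= <x, y>} misses every
   member, since <x, y> <= d M ||x|| < <x, x> on them.
   For (ii), let H = {y | c <= <u, y>} contain a x and have minimal hits. If H
   misses b x, then <u, x> < 0, so c <= 0, and b x belongs to the halfspace
   {y | <u, y> <= c}, which is contained in -H because c <= - c. By symmetry -H
   meets as many members as H. *)
Require Import Defs.
From HB Require Import structures.
From mathcomp Require Import all_boot all_order all_algebra finmap.
From mathcomp Require Import all_classical all_reals all_analysis.
From mathcomp Require Import lra.

Set Implicit Arguments.
Unset Strict Implicit.
Unset Printing Implicit Defensive.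

Import Order.TTheory GRing.Theory Num.Theory.
Import numFieldNormedType.Exports.

Local Open Scope classical_set_scope.
Local Open Scope ring_scope.

Section DotProduct.
Context {R : realType} {d : nat}.
Implicit Types (u x y : 'rV[R]_d) (k M : R).

Lemma dotNl u y : dot (- u) y = - dot u y.
Proof. by rewrite /dot -sumrN; apply: eq_bigr => i _; rewrite mxE mulNr. Qed.

Lemma dotZr k u y : dot u (k *: y) = k * dot u y.
Proof. by rewrite /dot mulr_sumr; apply: eq_bigr => i _; rewrite mxE mulrCA. Qed.

Lemma dotNr u y : dot u (- y) = - dot u y.
Proof. by rewrite -scaleN1r dotZr mulN1r. Qed.

Lemma dotxx_ge0 x : 0 <= dot x x.
Proof. by apply: sumr_ge0 => i _; rewrite -expr2 sqr_ge0. Qed.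

Lemma enorm_ge0 x : 0 <= enorm x.
Proof. exact: sqrtr_ge0. Qed.

Lemma enorm_sqr x : enorm x ^+ 2 = dot x x.
Proof. by rewrite sqr_sqrtr ?dotxx_ge0. Qed.

Lemma enorm0 : enorm (0 : 'rV[R]_d) = 0.
Proof. by rewrite /enorm /dot big1 ?sqrtr0 // => i _; rewrite mxE mul0r. Qed.

Lemma coord_le_enorm x i : `|x ord0 i| <= enorm x.
Proof.
rewrite -sqrtr_sqr ler_sqrt ?dotxx_ge0// /dot (bigD1 i)//= -expr2 lerDl.
by apply: sumr_ge0 => j _; rewrite -expr2 sqr_ge0.
Qed.

Lemma coord_le_norm y i : `|y ord0 i| <= `|y|.
Proof.
rewrite [leRHS]/Num.Def.normr /= mx_normrE; apply/bigmax_geP; right => /=.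
by exists (ord0, i).
Qed.

(** Each of the [d] products is at most [M * enorm x]. The bound on [y] is in the sup norm, the one
    in which [bounded_set] is stated. *)
Lemma dot_le_enorm x y M : `|y| <= M -> dot x y <= d%:R * M * enorm x.
Proof.
move=> yM; have -> : d%:R * M * enorm x = \sum_(i < d) M * enorm x.
  by rewrite sumr_const card_ord -mulrA mulr_natl.
apply: ler_sum => i _; rewrite (le_trans (ler_norm _))// normrM mulrC.
by rewrite ler_pM// ?coord_le_enorm// (le_trans (coord_le_norm y i)).
Qed.

End DotProduct.

Section Depth.
Context {R : realType} {d : nat}.
Implicit Types (x : 'rV[R]_d) (A H : set 'rV[R]_d) (F : set (set 'rV[R]_d)).

Lemma depth_le F H x : (0 < d)%N -> closed_halfspace H -> H x ->
  (depth F x <= hits F H)%N.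
Proof. by move=> d0; have [_] := depthP F x d0; apply. Qed.

Lemma hits_eq0 F H : (forall A, F A -> A `&` H = set0) -> hits F H = 0%N.
Proof.
move=> FH; rewrite /hits (_ : mkset _ = set0) ?fset_set0 ?cardfs0//.
by rewrite -subset0 => A [/FH -> [? []]].
Qed.

Lemma finite_hits F H : finite_set F ->
  finite_set [set A | F A /\ A `&` H !=set0].
Proof. by apply: sub_finite_set => A []. Qed.

Lemma hits_mono F H H' : finite_set F -> H `<=` H' -> (hits F H <= hits F H')%N.
Proof.
move=> finF HH'; apply: fsubset_leq_card.
rewrite -fset_set_sub; [|exact: finite_hits..].
by move=> A [FA [y [Ay /HH' H'y]]]; split=> //; exists y.
Qed.

(** If [A] meets [-H], then [-A] is a member that meets [H]. So the members meeting [-H] lie in the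
    image of [T] under negation, and an image has no more elements than its source. *)
Lemma hits_opp F H : finite_set F -> symmetric_family F ->
  (hits F [set - y | y in H] <= hits F H)%N.
Proof.
move=> finF symF; rewrite /hits; set T := [set A | F A /\ A `&` H !=set0].
have finT : finite_set T := finite_hits H finF.
pose opp_set A := [set - y | y in A].
apply: (@leq_trans #|` fset_set (opp_set @` T)|).
  apply: fsubset_leq_card; rewrite -fset_set_sub.
  - move=> A [FA [z [Az [y Hy yz]]]]; exists (opp_set A).
      split; first exact: symF.
      by exists y; split=> //; exists z => //; rewrite -yz opprK.
    (* Negation is an involution, so [A] is the image of [opp_set A]. *)
    rewrite /opp_set image_comp (_ : _ \o _ = id) ?image_id//.
    by apply/funext => w /=; rewrite opprK.
  - exact: finite_hits.
  - exact: finite_image.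
by rewrite fset_set_image//; apply: (leq_trans (leq_imfset_card _ _ _)).
Qed.

(** For each member, all large [M] are bounds; a finite intersection of such sets of bounds still
    belongs to the filter at [+oo]. *)
Lemma finite_bounded_family F : finite_set F ->
  (forall A, F A -> bounded_set A) ->
  exists M : R, forall A x, F A -> A x -> `|x| <= M.
Proof.
move=> finF bF.
have /pinfty_ex_gt0[M _ FM] : \forall M \near +oo,
    (\bigcap_(A in [set` fset_set F]) [set M : R | forall x, A x -> `|x| <= M]) M.
  by apply: filter_bigI => A; rewrite in_fset_set// inE => /bF.
by exists M => A x FA; apply: FM => /=; rewrite in_fset_set// inE.
Qed.

Lemma depth_near0 F : (0 < d)%N -> finite_set F ->
  (forall A, F A -> bounded_set A) ->
  \forall x \near @enorm_infty R d, depth F x = 0%N.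
Proof.
move=> d0 finF /finite_bounded_family-/(_ finF)[M FM].
(* The maximum with 0 forces [x] to be nonzero, so that [H] below is a genuine halfspace; the [+ 1]
   makes both inequalities strict. *)
exists (Num.max 0 (d%:R * M) + 1) => // x /= lx.
have : Num.max 0 (d%:R * M) < enorm x by rewrite (lt_le_trans _ lx)// ltrDl.
rewrite gt_max => /andP[x0 Mx]; apply/eqP; rewrite -leqn0.
pose H := [set y | dot x x <= dot x y].
rewrite -(@hits_eq0 F H).
  apply: depth_le => //; last exact: lexx.
  exists x, (dot x x); split=> //.
  by apply: contraTneq x0 => ->; rewrite enorm0 ltxx.
move=> A FA; rewrite -subset0 => y [/(FM _ _ FA) yM]; apply/negP.
by rewrite -ltNge (le_lt_trans (dot_le_enorm x yM))// -enorm_sqr expr2 ltr_pM2r.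
Qed.

Lemma depth_ray_anti F x (a b : R) : (0 < d)%N -> finite_set F ->
  symmetric_family F -> 0 <= a -> a <= b ->
  (depth F (b *: x) <= depth F (a *: x))%N.
Proof.
move=> d0 finF symF a0 ab.
have [[H [[u [c [u0 HE]]] Ha <-]] _] := depthP F (a *: x) d0.
have [cb|bc] := leP c (dot u (b *: x)).
  by apply: depth_le => //; [exists u, c | rewrite HE].
move: Ha bc; rewrite HE /= !dotZr => ca bc.
(* Otherwise [c <= a * dot u x <= b * dot u x < c]. *)
have ux : dot u x < 0.
  rewrite ltNge; apply/negP => ux.
  by have := le_lt_trans (le_trans ca (ler_wpM2r ux ab)) bc; rewrite ltxx.
have c0 : c <= 0 by rewrite (le_trans ca)// mulr_ge0_le0// ltW.
(* This is the set where [dot u y <= c], with signs flipped to match the form in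
   [closed_halfspace]. *)
pose H' := [set y | - c <= dot (- u) y].
apply: (@leq_trans (hits F H')).
  apply: depth_le => //; first by exists (- u), (- c); rewrite oppr_eq0.
  by rewrite /H' /= dotNl lerN2 dotZr ltW.
apply: leq_trans (hits_opp _ finF symF); apply: hits_mono => // y.
rewrite /H' /= dotNl lerN2 => uc; exists (- y); last by rewrite opprK.
rewrite /= dotNr; lra.
Qed.

End Depth.

Theorem theorem1 (R : realType) (d : nat) (d_gt0 : (0 < d)%N) :
  (forall F : set (set 'rV[R]_d),
     finite_set F ->
     (forall A, F A -> convex_set A /\ bounded_set A) ->
     ((depth F x)%:R : R) @[x --> @enorm_infty R d] --> (0 : R))
  /\
  (forall F : set (set 'rV[R]_d),
     finite_set F ->
     (forall A, F A -> convex_set A) ->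
     symmetric_family F ->
     forall (x : 'rV[R]_d) (a b : R),
       0 <= a -> a <= b ->
       (depth F (b *: x) <= depth F (a *: x))%N).
Proof.
split=> [F finF bF|F finF _ symF x a b a0 ab]; last exact: depth_ray_anti.
(* The depth is not merely small but exactly 0 far from the origin. *)
apply: cvg_near_cst.
apply: filterS (depth_near0 d_gt0 finF (fun A FA => (bF A FA).2)).
by move=> x ->.
Qed.
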